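(* Let $k=k(n)$ and $\Delta=\Delta(n)$ be integer-valued nondecreasing functions of $n$ tending to infinity with $k<\Delta$. For each $n$ let $G=G(n)$ be a graph on $n$ vertices with maximum degree at most $\Delta$, and let $L$ be a random $(k,\mathcal{C})$-list assignment for $G$, where $|\mathcal{C}|=\sigma=\sigma(n)$. (i) If $k=o(\log n)$, then for any constant $\epsilon>0$, if $\sigma(n)\ge(1+\epsilon)n^{1/k}\Delta k$, then with high probability $G$ is $L$-colorable. (ii) If $k\ge C\log n$, where $C>0$ is some constant, then for any constant $\epsilon>0$, if $\sigma\ge(1+\epsilon)C\exp(1/C)\Delta\log n$, then with high probability $G$ is $L$-colorable.
   Context: Graphs are finite and simple; $\log$ is the natural logarithm. A list assignment $L$ for a graph $G$ assigns to each vertex $v$ a set $L(v)$ of colors. $G$ is $L$-colorable if there is a proper vertex coloring $\varphi$ of $G$ with $\varphi(v)\in L(v)$ for every $v\in V(G)$. A random $(k,\mathcal{C})$-list assignment for $G$, where $\mathcal{C}=\{1,2,\dots,\sigma\}$ (with $\sigma=\sigma(n)\ge k(n)$), is obtained by choosing, for each vertex $v$, the list $L(v)$ independently and uniformly at random from all $k$-element subsets of $\mathcal{C}$. An event $A_n$ occurs with high probability if $\lim_{n\to\infty}\mathbb{P}[A_n]=1$. Asymptotic notation is with respect to $n\to\infty$. *)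

(* Defs.v *)
From HB Require Import structures.
From mathcomp Require Import all_boot all_order all_algebra.
From mathcomp Require Import all_classical all_reals all_analysis.

Set Implicit Arguments.
Unset Strict Implicit.
Unset Printing Implicit Defensive.

Import Order.TTheory GRing.Theory Num.Theory.
Import numFieldNormedType.Exports.

Local Open Scope classical_set_scope.
Local Open Scope ring_scope.

Record sgraph := SGraph {
  vertex :> finType;
  adj : rel vertex;
  adj_sym : symmetric adj;
  adj_irrefl : irreflexive adj }.

Definition degree (G : sgraph) (v : G) : nat := #|[set w : G | adj v w]%SET|.

Definition max_degree (G : sgraph) : nat := \max_(v : G) degree v.

Definition list_assignment (G : sgraph) (sigma : nat) : finType :=
  {ffun G -> {set 'I_sigma}}.

Definition proper_coloring (G : sgraph) (sigma : nat)
    (phi : {ffun G -> 'I_sigma}) : bool :=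
  [forall u : G, forall v : G, adj u v ==> (phi u != phi v)].

Definition list_colorable (G : sgraph) (sigma : nat)
    (L : list_assignment G sigma) : bool :=
  [exists phi : {ffun G -> 'I_sigma},
     proper_coloring phi && [forall v : G, phi v \in L v]].

(* Probability that a uniformly random k-element subset of the colors is S. *)
Definition list_prob (R : realType) (k sigma : nat) (S : {set 'I_sigma}) : R :=
  if #|S| == k then 'C(sigma, k)%:R^-1 else 0.

(* The lists of distinct vertices are independent, so the probability of an
   assignment L is the product over the vertices v of that of L v; this is a
   probability distribution provided that k <= sigma. *)
Definition random_lists_prob (R : realType) (G : sgraph) (k sigma : nat)
    (A : pred (list_assignment G sigma)) : R :=
  \sum_(L : list_assignment G sigma | A L) \prod_(v : G) list_prob R k (L v).

Definition with_high_probability (R : realType) (p : nat -> R) : Prop :=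
  p n @[n --> \oo] --> (1 : R).

(* Main.v *)
Require Import Defs.
From HB Require Import structures.
From mathcomp Require Import all_boot all_order all_algebra.
From mathcomp Require Import all_classical all_reals all_analysis.
From mathcomp Require Import zify ring lra.

(** A vertex v whose list contains a color absent from all the lists of its
    neighbors can be given that color without any possible conflict.  So if no
    coloring from the lists exists, then some v is blocked: L(v) is contained in
    the union U of the lists of its neighbors ([blocked_of_not_colorable]).
    Since U depends only on lists other than L(v) and has at most Delta * k
    elements, the k-subset L(v) lies in U with probability
    'C(|U|, k) / 'C(sigma, k) <= (Delta * k / sigma)^k
    ([blocked_at_prob_le]), and a union bound over the n vertices gives failure
    probability at most n * (Delta * k / sigma)^k ([list_colorable_prob_ge]).

    Hence it suffices that sigma >= (1 + eps) * B * Delta * k for some B with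
    B^k >= n, because the bound is then at most (1 + eps)^(-k), which tends to
    0.  In part (i), B = n^(1/k).  In part (ii) the lists may be much longer
    than log n, while the lower bound on sigma has C log n in place of k.  But
    colorability is monotone in the lists, and a uniformly random j-subset of a
    uniformly random k-subset is a uniformly random j-subset, so shortening the
    lists to j = ceil(C log n) colors only lowers the probability
    ([random_lists_prob_mono]).  Then B = exp(1/C) works, as
    B^j >= exp(log n) = n, and the rounding in j is absorbed by replacing eps
    with eps / 2. *)

Set Implicit Arguments.
Unset Strict Implicit.
Unset Printing Implicit Defensive.

Import Order.TTheory GRing.Theory Num.Theory.
Import numFieldNormedType.Exports.

Local Open Scope classical_set_scope.
Local Open Scope ring_scope.

(** * The uniform distribution on k-subsets *)

Lemma list_prob_ge0 (R : realType) (k sigma : nat) (S : {set 'I_sigma}) :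
  0 <= list_prob R k S.
Proof. by rewrite /list_prob; case: ifP => // _; rewrite invr_ge0. Qed.

Lemma list_prob_subset (R : realType) (k sigma : nat) (U : {set 'I_sigma}) :
  \sum_(S : {set 'I_sigma} | S \subset U) list_prob R k S =
  'C(#|U|, k)%:R / 'C(sigma, k)%:R.
Proof.
rewrite /list_prob -big_mkcondr /= sumr_const -cards_draws mulr_natl.
by rewrite cardsE.
Qed.

Lemma sum_list_prob (R : realType) (k sigma : nat) :
  (k <= sigma)%N -> \sum_(S : {set 'I_sigma}) list_prob R k S = 1.
Proof.
move=> le_k; have := list_prob_subset R k [set: 'I_sigma]%SET.
rewrite cardsT card_ord divff ?pnatr_eq0 -?lt0n ?bin_gt0// => <-.
by apply: eq_bigl => S; rewrite finset.subsetT.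
Qed.

(** After clearing k! this compares falling factorials factor by factor:
    (m - i) / (s - i) <= m / s whenever m <= s. *)
Lemma bin_mul_exp_le (m s k : nat) :
  (m <= s)%N -> ('C(m, k) * s ^ k <= 'C(s, k) * m ^ k)%N.
Proof.
move=> le_ms; rewrite -(leq_pmul2r (fact_gt0 k)) ![(_ * _ * k`!)%N]mulnAC.
rewrite !bin_ffact; elim: k => [|k IH]; first by rewrite !ffactn0.
rewrite !ffactnSr !expnSr mulnACA [leqRHS]mulnACA leq_mul//.
rewrite !mulnBl; apply: leq_sub; first by rewrite mulnC.
by rewrite leq_mul2l le_ms orbT.
Qed.

Lemma list_prob_subset_le (R : realType) (k sigma : nat) (U : {set 'I_sigma}) :
  (k <= sigma)%N ->
  \sum_(S : {set 'I_sigma} | S \subset U) list_prob R k S <=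
  (#|U|%:R / sigma%:R) ^+ k.
Proof.
move=> le_k; have le_U : (#|U| <= sigma)%N.
  by rewrite -[leqRHS]card_ord max_card.
rewrite list_prob_subset; case: k le_k => [|k] le_k.
  by rewrite !bin0 divr1.
have s_gt0 : (0 < sigma)%N by apply: leq_trans le_k.
rewrite expr_div_n ler_pdivrMr ?ltr0n ?bin_gt0// mulrAC.
rewrite ler_pdivlMr ?exprn_gt0 ?ltr0n// -!natrX -!natrM ler_nat.
by rewrite [leqRHS]mulnC bin_mul_exp_le.
Qed.

(** * A union bound over blocked vertices *)

Section RandomLists.
Variables (R : realType) (G : sgraph) (k sigma : nat).
Implicit Types (L : list_assignment G sigma).
Implicit Types (A : pred (list_assignment G sigma)).

Definition lists_weight L : R := \prod_(v : G) list_prob R k (L v).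

Lemma lists_weight_ge0 L : 0 <= lists_weight L.
Proof. by apply: prodr_ge0 => v _; apply: list_prob_ge0. Qed.

Lemma card_list_of_weight L : lists_weight L != 0 -> forall v, #|L v| = k.
Proof.
move=> /prodf_neq0 H v; have := H v isT; rewrite /list_prob.
by case: (#|L v| =P k) => // _ /eqP.
Qed.

Hypothesis le_k_sigma : (k <= sigma)%N.

Lemma sum_lists_weight : \sum_L lists_weight L = 1.
Proof.
transitivity (\prod_(v : G) \sum_S @list_prob R k sigma S).
  by rewrite bigA_distr_bigA.
by rewrite big1// => v _; apply: sum_list_prob.
Qed.

Lemma random_lists_probC A :
  random_lists_prob R k A = 1 - random_lists_prob R k (predC A).
Proof.
by rewrite -sum_lists_weight (bigID A) /= addrK.
Qed.

Definition resample (v : G) L (S : {set 'I_sigma}) : list_assignment G sigma :=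
  [ffun w => if w == v then S else L w].

(** Independence of the list at v from all the other lists, in the form of an
    invariance: redrawing the list at v does not change the distribution.
    Exchanging L(v) with the fresh list S is an involution of the pairs (L, S)
    that preserves their weight. *)
Lemma sum_resample (v : G) (f : list_assignment G sigma -> R) :
  \sum_L lists_weight L * f L =
  \sum_L lists_weight L * \sum_S list_prob R k S * f (resample v L S).
Proof.
under [RHS]eq_bigr do rewrite big_distrr /=.
pose swap (p : list_assignment G sigma * {set 'I_sigma}) :=
  (resample v p.1 p.2, p.1 v).
have swapK : involutive swap.
  move=> [L S]; congr pair; last by rewrite ffunE eqxx.
  by apply/ffunP => w; rewrite !ffunE; case: eqP => // ->.
rewrite pair_bigA (reindex_inj (inv_inj swapK)) /=.
transitivity (\sum_L \sum_S lists_weight L * (@list_prob R k sigma S * f L)).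
  apply: eq_bigr => L _; rewrite -big_distrr /= -big_distrl /=.
  by rewrite sum_list_prob ?mul1r.
rewrite pair_bigA /=; apply: eq_bigr => -[L S] _ /=.
have -> : resample v (resample v L S) (L v) = L.
  by case: (swapK (L, S)).
rewrite !mulrA; congr (_ * _).
rewrite /lists_weight (bigD1 v) // [in RHS](bigD1 v) //= ffunE eqxx.
rewrite mulrAC [RHS]mulrAC; congr (_ * _); first by rewrite mulrC.
by apply: eq_bigr => w /negPf w_v; rewrite ffunE w_v.
Qed.

Definition blocked_at (v : G) : pred (list_assignment G sigma) :=
  fun L => L v \subset (\bigcup_(u | adj v u) L u)%SET.

(** If no vertex is blocked, choosing at every v a color of L(v) outside all
    the neighboring lists is a proper coloring, since the two ends of an edge
    cannot make the same choice. *)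
Lemma blocked_of_not_colorable L :
  ~~ list_colorable L -> exists v, blocked_at v L.
Proof.
move=> /existsPn nL; apply/existsP; apply: contraT => /existsPn free.
have {}free v :
    exists c, (c \in L v) && (c \notin (\bigcup_(u | adj v u) L u)%SET).
  by have /fintype.subsetPn[c cL cU] := free v; exists c; rewrite cL.
pose phi := [ffun v => xchoose (free v)].
have := nL phi; rewrite negb_and.
case/orP=> [/forallPn[u /forallPn[v]]|/forallPn[v]].
  rewrite negb_imply negbK !ffunE => /andP[uv /eqP phi_uv].
  have /andP[_] := xchooseP (free u); rewrite phi_uv => /negP[].
  by apply/bigcupP; exists v => //; case/andP: (xchooseP (free v)).
by rewrite ffunE; case/andP: (xchooseP (free v)) => ->.
Qed.

Lemma card_neighbor_colors L (v : G) (D : nat) :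
  (max_degree G <= D)%N -> lists_weight L != 0 ->
  (#|(\bigcup_(u | adj v u) L u)%SET| <= D * k)%N.
Proof.
move=> degG L0.
have le_card :
    (#|(\bigcup_(u | adj v u) L u)%SET| <= \sum_(u | adj v u) #|L u|)%N.
  apply: (big_ind2 (fun (X : {set _}) n => (#|X| <= n)%N)) => //.
  - by rewrite cards0.
  - move=> X m Y n Xm Yn; apply: leq_trans (leq_add Xm Yn).
    by rewrite (leq_card_setU X Y).
apply: leq_trans le_card _.
rewrite (eq_bigr (fun=> k)); last by move=> u _; apply: card_list_of_weight.
rewrite sum_nat_const leq_mul2r; apply/orP; right.
apply: leq_trans degG; rewrite -cardsE.
exact: (leq_bigmax (F := @degree G) v).
Qed.

(** Redraw the list S at v with the other lists fixed: the union U of the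
    neighboring lists does not change, as v is not its own neighbor, and the
    event becomes that the uniform k-set S falls inside U. *)
Lemma blocked_at_prob_le (v : G) (D : nat) :
  (max_degree G <= D)%N ->
  random_lists_prob R k (blocked_at v) <= (D%:R * k%:R / sigma%:R) ^+ k.
Proof.
move=> degG.
have -> : random_lists_prob R k (blocked_at v) =
    \sum_L lists_weight L * (blocked_at v L)%:R.
  rewrite /random_lists_prob big_mkcond; apply: eq_bigr => L _.
  by case: (blocked_at v L); rewrite ?mulr1 ?mulr0.
rewrite (sum_resample v) -[leRHS]mul1r -[X in _ <= X * _]sum_lists_weight.
rewrite big_distrl /=.
apply: ler_sum => L _; have [->|L0] := eqVneq (lists_weight L) 0.
  by rewrite !mul0r.
apply: ler_wpM2l; first exact: lists_weight_ge0.
pose U := (\bigcup_(u | adj v u) L u)%SET.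
have blockedE S : blocked_at v (resample v L S) = (S \subset U).
  rewrite /blocked_at ffunE eqxx.
  suff -> : (\bigcup_(u | adj v u) resample v L S u)%SET = U by [].
  apply: eq_bigr => u vu; rewrite ffunE; case: eqP vu => // ->.
  by rewrite adj_irrefl.
under eq_bigr do rewrite blockedE mulrC mulr_natl mulrb.
rewrite -big_mkcond /=.
apply: le_trans (list_prob_subset_le R U le_k_sigma) _.
apply: lerXn2r; rewrite ?nnegrE ?divr_ge0 ?mulr_ge0//.
by rewrite ler_wpM2r ?invr_ge0// -natrM ler_nat card_neighbor_colors.
Qed.

Lemma list_colorable_prob_ge (D : nat) :
  (max_degree G <= D)%N ->
  1 - #|G|%:R * (D%:R * k%:R / sigma%:R) ^+ k <=
  random_lists_prob R k (@list_colorable G sigma).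
Proof.
move=> degG; rewrite random_lists_probC lerD2l lerN2.
have -> : #|G|%:R * (D%:R * k%:R / sigma%:R) ^+ k =
    \sum_(v : G) (D%:R * k%:R / sigma%:R) ^+ k :> R.
  by rewrite sumr_const mulr_natl.
apply: (@le_trans _ _ (\sum_(v : G) random_lists_prob R k (blocked_at v))).
  2: by apply: ler_sum => v _; apply: blocked_at_prob_le.
rewrite /random_lists_prob.
under [leRHS]eq_bigr do rewrite big_mkcond.
rewrite exchange_big /= big_mkcond /=; apply: ler_sum => L _.
have ge0 v : 0 <= if blocked_at v L then lists_weight L else 0.
  by case: ifP => // _; apply: lists_weight_ge0.
case: ifPn => [/blocked_of_not_colorable[v vL]|_]; last exact: sumr_ge0.
by rewrite [leRHS](bigD1 v) //= vL lerDl sumr_ge0.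
Qed.

Lemma random_lists_prob_le1 A : random_lists_prob R k A <= 1.
Proof.
rewrite random_lists_probC gerBl sumr_ge0// => L _.
exact: lists_weight_ge0.
Qed.

End RandomLists.

(** * Monotonicity in the list size *)

(** The probability that a uniformly random j-subset of the k-set S is T. *)
Definition subset_kernel (R : realType) (k j sigma : nat)
    (S T : {set 'I_sigma}) : R :=
  if (T \subset S) && (#|T| == j) then 'C(k, j)%:R^-1 else 0.

Lemma card_supersets (sigma k : nat) (T : {set 'I_sigma}) :
  (k <= sigma)%N ->
  #|[set S : {set 'I_sigma} | T \subset S & #|S| == k]%SET| =
  'C(sigma - #|T|, sigma - k).
Proof.
move=> le_k; have <- : #|~: T| = (sigma - #|T|)%N.
  by rewrite cardsCs finset.setCK card_ord.
rewrite -cards_draws -(card_imset _ (inv_inj (@finset.setCK _))).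
apply: eq_card => S; apply/imsetP/idP => [[X]|]; rewrite inE.
  move=> /andP[TX /eqP cX] ->; rewrite inE finset.setCS TX /=.
  by rewrite cardsCs finset.setCK card_ord cX.
move=> /andP[ST /eqP cS]; exists (~: S)%SET; last by rewrite finset.setCK.
rewrite inE -finset.setCS finset.setCK ST /=.
by rewrite cardsCs finset.setCK card_ord cS subKn.
Qed.

(** Choosing a uniform k-set and then a uniform j-subset of it yields a uniform
    j-set.  The identity behind it counts the pairs T <= S with #|T| = j and
    #|S| = k in two ways. *)
Lemma list_prob_subset_kernel (R : realType) (j k sigma : nat)
    (T : {set 'I_sigma}) :
  (j <= k <= sigma)%N ->
  \sum_(S : {set 'I_sigma}) list_prob R k S * subset_kernel R k j S T =
  list_prob R j T.
Proof.
move=> /andP[jk ks]; have js := leq_trans jk ks.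
rewrite /list_prob /subset_kernel; case: eqP => [cT|_]; last first.
  by rewrite big1// => S _; rewrite andbF mulr0.
transitivity (\sum_(S in [set S : {set 'I_sigma} | T \subset S & #|S| == k]%SET)
    ('C(sigma, k)%:R^-1 * 'C(k, j)%:R^-1 : R)).
  rewrite [RHS]big_mkcond; apply: eq_bigr => S _; rewrite inE andbT andbC.
  by case: (T \subset S); case: (#|S| == k); rewrite ?mul0r ?mulr0.
rewrite sumr_const card_supersets// cT -[LHS]mulr_natl -invfM -natrM.
have binE :
    ('C(sigma - j, sigma - k) * 'C(sigma, j) = 'C(sigma, k) * 'C(k, j))%N.
  have f0 : (0 < j`! * (k - j)`! * (sigma - k)`!)%N.
    by rewrite !muln_gt0 !fact_gt0.
  apply/eqP; rewrite -(eqn_pmul2r f0); apply/eqP.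
  transitivity sigma`!.
    rewrite -(bin_fact js) -(bin_fact (leq_sub2l sigma jk)).
    by have -> : (sigma - j - (sigma - k) = k - j)%N; lia.
  by rewrite -(bin_fact ks) -(bin_fact jk); lia.
have bin0 n m : (m <= n)%N -> 'C(n, m)%:R != 0 :> R.
  by move=> mn; rewrite pnatr_eq0 -lt0n bin_gt0.
apply: (mulIf (bin0 _ _ js)); rewrite mulVf ?bin0// mulrAC -natrM binE.
by rewrite mulfV// natrM mulf_neq0 ?bin0.
Qed.

(** A coupling: draw lists of size j as independent random subsets of lists of
    size k.  If the smaller lists satisfy the up-closed property A, so do the
    larger ones. *)
Lemma random_lists_prob_mono (R : realType) (G : sgraph) (j k sigma : nat)
    (A : pred (list_assignment G sigma)) :
  (j <= k <= sigma)%N ->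
  (forall L L' : list_assignment G sigma,
     (forall v, L' v \subset L v) -> A L' -> A L) ->
  random_lists_prob R j A <= random_lists_prob R k A.
Proof.
move=> jks A_up; have /andP[jk ks] := jks.
rewrite /random_lists_prob.
under eq_bigr => L' _.
  under eq_bigr do rewrite -(list_prob_subset_kernel R _ jks).
  rewrite bigA_distr_bigA /=.
  under eq_bigr do rewrite big_split /=.
  over.
rewrite exchange_big /= [leRHS]big_mkcond /=; apply: ler_sum => L _.
have ker_ge0 S T : 0 <= subset_kernel R k j S T :> R.
  by rewrite /subset_kernel; case: ifP => // _; rewrite invr_ge0.
rewrite -big_distrr /=; have [L0|L0] := eqVneq (lists_weight R k L) 0.
  rewrite [X in X * _]L0 mul0r; case: ifP => // _.
  exact: lists_weight_ge0.
(* The kernels out of a fixed assignment of k-sets form a distribution. *)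
have total : \sum_(L' : list_assignment G sigma)
    \prod_v subset_kernel R k j (L v) (L' v) = 1.
  transitivity (\prod_(v : G) \sum_T subset_kernel R k j (L v) T).
    by rewrite bigA_distr_bigA.
  rewrite big1// => v _; rewrite /subset_kernel -big_mkcond /= sumr_const.
  rewrite -cardsE cards_draws (card_list_of_weight L0) -[LHS]mulr_natl divff//.
  by rewrite pnatr_eq0 -lt0n bin_gt0.
case: ifPn => [_|nA].
  rewrite -[leRHS]mulr1 -[X in _ <= _ * X]total ler_wpM2l ?lists_weight_ge0//.
  rewrite [leLHS]big_mkcond; apply: ler_sum => L' _; case: ifP => // _.
  by apply: prodr_ge0 => v _; apply: ker_ge0.
rewrite [X in _ * X]big1 ?mulr0// => L' AL'.
have /forallPn[v Lv] : ~~ [forall v, L' v \subset L v].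
  by apply: contra nA => /forallP sub; apply: A_up AL'.
by rewrite (bigD1 v) //= /subset_kernel (negPf Lv) mul0r.
Qed.

Lemma list_colorable_mono (G : sgraph) (sigma : nat)
    (L L' : list_assignment G sigma) :
  (forall v, L' v \subset L v) -> list_colorable L' -> list_colorable L.
Proof.
move=> sub /existsP[phi /andP[proper /forallP inL']].
apply/existsP; exists phi; rewrite proper; apply/forallP => v.
exact: (fintype.subsetP (sub v)).
Qed.

(** * Asymptotics *)

(** The condition common to both parts: j n is the size to which the lists may
    be shortened, and B n is any base whose j n-th power beats the union bound
    over n vertices.  The failure probability is then at most
    (1 + eps)^(- j n). *)
Lemma list_colorable_whp (R : realType) (k Delta sigma : nat -> nat)
    (G : nat -> sgraph) (j : nat -> nat) (B : nat -> R) (eps : R) :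
  (forall n, (k n <= sigma n)%N) ->
  (forall n, #|G n| = n) ->
  (forall n, (max_degree (G n) <= Delta n)%N) ->
  0 < eps ->
  j n @[n --> \oo] --> \oo ->
  (\forall n \near \oo, [/\ (j n <= k n)%N, 0 <= B n, n%:R <= B n ^+ j n &
     (1 + eps) * B n * (Delta n)%:R * (j n)%:R <= (sigma n)%:R]) ->
  with_high_probability (fun n =>
    random_lists_prob R (k n) (@list_colorable (G n) (sigma n))).
Proof.
move=> ks cG dG eps0 joo H.
have e1 : 0 < 1 + eps by rewrite addr_gt0.
pose q := (1 + eps)^-1.
have q01 : `|q| < 1.
  by rewrite ger0_norm ?invr_ge0 ?ltW// invf_lt1// ltrDl.
apply: (@squeeze_cvgr _ _ _ _ (fun n => 1 - q ^+ j n) (fun=> 1)).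
- near=> n.
  have [jk B0 nB sB] : [/\ (j n <= k n)%N, 0 <= B n, n%:R <= B n ^+ j n &
     (1 + eps) * B n * (Delta n)%:R * (j n)%:R <= (sigma n)%:R] by near: n.
  rewrite random_lists_prob_le1// andbT.
  apply: (le_trans _ (@random_lists_prob_mono R (G n) (j n) _ _ _ _ _)).
  + apply: le_trans (list_colorable_prob_ge R (leq_trans jk (ks n)) (dG n)).
    rewrite cG lerD2l lerN2.
    set x := _ / _; have x0 : 0 <= x by rewrite divr_ge0 ?mulr_ge0.
    apply: (@le_trans _ _ ((B n * x) ^+ j n)).
      by rewrite [leRHS]exprMn ler_wpM2r ?exprn_ge0.
    have q0 : 0 <= q by rewrite invr_ge0 ltW.
    apply: lerXn2r; rewrite ?nnegrE ?mulr_ge0//.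
    rewrite /q -[leRHS]mul1r ler_pdivlMr// /x !mulrA.
    have [->|s0] := eqVneq (sigma n) 0%N; first by rewrite invr0 mulr0 mul0r.
    rewrite mulrAC ler_pdivrMr ?ltr0n ?lt0n// mul1r.
    by apply: le_trans sB; rewrite mulrC !mulrA.
  + by rewrite jk ks.
  + exact: list_colorable_mono.
- rewrite -[X in _ --> X]subr0; apply: cvgB; first exact: cvg_cst.
  exact: (cvg_comp _ _ joo (cvg_expr q01)).
- exact: cvg_cst.
Unshelve. all: by end_near. Qed.

Lemma near_ln_ge (R : realType) (a : R) : \forall n \near \oo, a <= ln n%:R.
Proof.
near=> n; have : expR a <= n%:R by near: n; apply: nbhs_infty_ger.
move=> an; rewrite -[leLHS]expRK ler_ln// posrE ?expR_gt0//.
by apply: lt_le_trans an; apply: expR_gt0.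
Unshelve. all: by end_near. Qed.

Unset Implicit Arguments.

Theorem proposition5p3 (R : realType) (k Delta sigma : nat -> nat)
    (G : nat -> sgraph)
    (k_nondecreasing : {homo k : m n / (m <= n)%N})
    (Delta_nondecreasing : {homo Delta : m n / (m <= n)%N})
    (k_infty : k n @[n --> \oo] --> \oo)
    (Delta_infty : Delta n @[n --> \oo] --> \oo)
    (k_lt_Delta : forall n, (k n < Delta n)%N)
    (k_le_sigma : forall n, (k n <= sigma n)%N)
    (card_G : forall n, #|G n| = n)
    (max_degree_G : forall n, (max_degree (G n) <= Delta n)%N) :
  ((fun n => (k n)%:R : R^o) =o_\oo (fun n => ln (n%:R : R) : R^o) ->
   forall eps : R, 0 < eps ->
   (forall n, (1 + eps) * n%:R `^ (k n)%:R^-1 * (Delta n)%:R * (k n)%:R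
              <= (sigma n)%:R) ->
   with_high_probability (fun n =>
     random_lists_prob R (k n) (@list_colorable (G n) (sigma n))))
  /\
  (forall C : R, 0 < C ->
   (forall n, C * ln n%:R <= (k n)%:R) ->
   forall eps : R, 0 < eps ->
   (forall n, (1 + eps) * C * expR C^-1 * (Delta n)%:R * ln n%:R
              <= (sigma n)%:R) ->
   with_high_probability (fun n =>
     random_lists_prob R (k n) (@list_colorable (G n) (sigma n)))).
Proof.
split=> [_ eps eps0 sB|C C0 kC eps eps0 sB].
  apply: (list_colorable_whp (j := k) (B := fun n => n%:R `^ (k n)%:R^-1)
           k_le_sigma card_G max_degree_G eps0 k_infty).
  near=> n; split=> //.
  have kn0 : (0 < k n)%N by near: n; move/cvgnyPge: k_infty; apply.
  by rewrite -powR_mulrn ?powR_ge0// -powRrM mulVf ?powRr1// pnatr_eq0 -lt0n.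
(* Lists are shortened to the least integer size that is at least C log n. *)
pose x n : R := C * ln n%:R.
pose j n := `|Num.ceil (x n)|%N.
have x_large a : \forall n \near \oo, a <= x n.
  apply: filterS (near_ln_ge (a / C)) => n.
  by rewrite ler_pdivrMr// mulrC.
have jE n : 0 <= x n -> (j n)%:R = (Num.ceil (x n))%:~R :> R.
  move=> x0; rewrite natr_absz ger0_norm// ceil_ge0.
  by apply: lt_le_trans x0; rewrite oppr_lt0.
have j_ge n : 0 <= x n -> x n <= (j n)%:R by move=> /jE ->; apply: ceil_ge.
have j_infty : j n @[n --> \oo] --> \oo.
  apply/cvgnyPge => a; near=> n; rewrite -(ler_nat R).
  apply: (@le_trans _ _ (x n)); first by near: n; apply: x_large.
  by apply: j_ge; near: n; apply: x_large.
have eps20 : 0 < eps / 2 by rewrite divr_gt0.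
apply: (list_colorable_whp (j := j) (B := fun=> expR C^-1)
         k_le_sigma card_G max_degree_G eps20 j_infty).
near=> n.
have x0 : 0 <= x n by near: n; apply: x_large.
have n0 : (0 < n)%N by near: n; apply: nbhs_infty_gt.
have jx : (j n)%:R <= x n + 1.
  by rewrite jE// -lerBlDr -[X in _ - X]/(1%:~R) -intrB ltW// ceilB1_lt.
split; first 2 [exact: expR_ge0].
- rewrite -(ler_nat R) jE//.
  have : (Num.ceil (x n) <= (k n : int)) by rewrite ceil_le_int; apply: kC.
  by rewrite -(ler_int R).
- rewrite -expRM_natl -[leLHS]lnK ?posrE ?ltr0n// ler_expR.
  by rewrite ler_pdivlMr// mulrC j_ge.
- apply: le_trans (sB n).
  have x_eps : (1 + eps / 2) / (eps / 2) <= x n by near: n; apply: x_large.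
  (* Rounding up costs at most 1 in j n, which is at most eps / 2 times x n /
     (1 + eps / 2) once x n is large. *)
  have je : (1 + eps / 2) * (j n)%:R <= (1 + eps) * x n.
    move: x_eps; rewrite ler_pdivrMr// => x_eps; nra.
  have -> : (1 + eps) * C * expR C^-1 * (Delta n)%:R * ln n%:R =
      (expR C^-1 * (Delta n)%:R) * ((1 + eps) * x n) by rewrite /x; ring.
  have -> : (1 + eps / 2) * expR C^-1 * (Delta n)%:R * (j n)%:R =
      (expR C^-1 * (Delta n)%:R) * ((1 + eps / 2) * (j n)%:R) by ring.
  by rewrite ler_wpM2l// mulr_ge0// expR_ge0.
Unshelve. all: by end_near. Qed.
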